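(* Let $N\ge 2$ and let $m_1,\dots,m_N$ be positive real numbers. There is a polynomial $Q\ne0$ in $N-1$ variables with real coefficients, which does not depend on $r_1,\dots,r_N,\sigma_1,\dots,\sigma_{N-1}$, such that $Q(\sigma_1,\dots,\sigma_{N-1})=0$ for every ratio vector $(\sigma_1,\dots,\sigma_{N-1})$, i.e. for the ratio vector of every function $p(x)=(x-r_1)^{m_1}\cdots(x-r_N)^{m_N}$ with $r_1<r_2<\cdots<r_N$ real.
   Context: For positive reals $m_1,\dots,m_N$ (fixed) and reals $r_1<\cdots<r_N$, let $p(x)=(x-r_1)^{m_1}\cdots(x-r_N)^{m_N}$. For each $k=1,\dots,N-1$, $p'$ has a unique root $x_k$ in $(r_k,r_{k+1})$ (for non-integer exponents any smooth branch of the powers may be fixed on the interval; $x_k$ is the unique zero of $p'/p=\sum_{j=1}^N\frac{m_j}{x-r_j}$ in $(r_k,r_{k+1})$). The ratios are $\sigma_k=\frac{x_k-r_k}{r_{k+1}-r_k}$, $k=1,\dots,N-1$, and $(\sigma_1,\dots,\sigma_{N-1})$ is called the ratio vector of $p$. *)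

(* Defs.v *)
From HB Require Import structures.
From mathcomp Require Import all_boot all_order all_algebra.
From mathcomp Require Import all_classical all_reals all_analysis.
From mathcomp Require Export (canonicals) mpoly.
From mathcomp Require Import ring lra.
Set Implicit Arguments.
Unset Strict Implicit.
Unset Printing Implicit Defensive.
Import Order.TTheory GRing.Theory Num.Theory.
Import numFieldNormedType.Exports.
Local Open Scope ring_scope.

(* Only the canonical structures of mpoly are imported: its notations conflict
   with those of the analysis library. *)
Notation mpoly := mpoly.mpoly.
Notation meval := mpoly.meval.

Lemma ltn_ord_succ N (k : 'I_N.-1) : (k.+1 < N)%N.
Proof. by rewrite -ltn_predRL. Qed.

Definition ord_left N (k : 'I_N.-1) : 'I_N := widen_ord (leq_pred N) k.
Definition ord_right N (k : 'I_N.-1) : 'I_N := Ordinal (ltn_ord_succ k).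

(* On each interval between consecutive r_j, any smooth branch of
   (x - r_1)^(m_1) ... (x - r_N)^(m_N) is this real function times a nonzero
   constant (a sign if all m_j are integers), so that the zeros of the
   derivative do not depend on the branch; see also is_derive_powprod. *)
Definition powprod (R : realType) (N : nat) (m r : 'I_N -> R) (x : R) : R :=
  \prod_(j < N) `|x - r j| `^ (m j).

Definition critical_point (R : realType) (N : nat) (m r : 'I_N -> R)
    (k : 'I_N.-1) (x : R) : Prop :=
  r (ord_left k) < x < r (ord_right k) /\
  is_derive x (1 : R) (powprod m r) 0.

Definition ratio_vector (R : realType) (N : nat) (m r : 'I_N -> R)
    (sigma : 'I_N.-1 -> R) : Prop :=
  exists x : 'I_N.-1 -> R, forall k : 'I_N.-1,
    critical_point m r k (x k) /\
    sigma k = (x k - r (ord_left k)) / (r (ord_right k) - r (ord_left k)).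

Lemma is_derive_norm_powR (R : realType) (a b x : R) : x != b ->
  is_derive x (1 : R) (fun y => `|y - b| `^ a) (`|x - b| `^ a * (a / (x - b))).
Proof.
move=> xb; set s := Num.sg (x - b).
have xb0 : x - b != 0 by rewrite subr_eq0.
have sxb : s * (x - b) = `|x - b| by rewrite -normrEsg.
have s0 : s != 0 by rewrite sgr_eq0.
have pos : 0 < s * (x - b) by rewrite sxb normr_gt0.
have Hd : is_derive x (1 : R) (fun y => (s * (y - b)) `^ a)
    (`|x - b| `^ a * (a / (x - b))).
  have Hlin : is_derive x (1 : R) (fun y => s * (y - b)) s.
    apply: is_derive_eq; rewrite ?scaler0 ?addr0 ?subr0.
    by rewrite /GRing.scale /= ?mulr1.
  have Hp : is_derive (s * (x - b)) (1 : R) (fun t => t `^ a)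
      (a * (s * (x - b)) `^ (a - 1)) by exact: is_derive1_powR.
  have E : `|x - b| `^ a * (a / (x - b)) = (a * (s * (x - b)) `^ (a - 1)) * s.
    rewrite -sxb powRB; last by rewrite (gt_eqF pos) implybT.
    rewrite powRr1 ?ltW//.
    by field; rewrite s0 xb0.
  rewrite E.
  exact: (@is_derive1_comp _ (fun t => t `^ a) (fun y => s * (y - b)) x _ _ Hp Hlin).
apply: near_eq_is_derive Hd.
have : {for x, continuous (fun y : R => s * (y - b))}.
  by apply: differentiable_continuous; exact/derivable1_diffP.
move=> /cvgr_gt /(_ _ pos).
apply: filterS => y sy.
by rewrite -(gtr0_norm sy) normrM /s normr_sg xb0 mul1r.
Qed.

Lemma is_derive_powprod (R : realType) (N : nat) (m r : 'I_N -> R) (x : R) :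
  (forall j, x != r j) ->
  is_derive x (1 : R) (powprod m r)
    (powprod m r x * \sum_(j < N) m j / (x - r j)).
Proof.
move=> xr; rewrite /powprod; elim: (index_enum _) => [|j s IH].
  rewrite !big_nil mulr0; under eq_fun do rewrite big_nil.
  exact: is_derive_cst.
under eq_fun do rewrite big_cons.
rewrite !big_cons.
have H := @is_derive_norm_powR R (m j) (r j) x (xr j).
have := is_deriveM H IH.
move=> K; apply: (is_derive_eq K).
rewrite /GRing.scale /=; ring.
Qed.

Lemma critical_pointP (R : realType) (N : nat) (m r : 'I_N -> R)
    (k : 'I_N.-1) (x : R) :
  {homo r : i j / (i < j)%N >-> i < j} ->
  critical_point m r k x <->
  r (ord_left k) < x < r (ord_right k) /\ \sum_(j < N) m j / (x - r j) = 0.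
Proof.
move=> rincr; rewrite /critical_point.
suff H : r (ord_left k) < x < r (ord_right k) ->
    is_derive x (1 : R) (powprod m r) 0 <->
    \sum_(j < N) m j / (x - r j) = 0.
  by split=> -[xk /(H xk)].
move=> /andP[kx xk].
have xr j : x != r j.
  have [jk|kj] := leqP j k.
    rewrite gt_eqF//; apply: le_lt_trans kx.
    move: jk; rewrite leq_eqVlt => /orP[/eqP jk|jk]; last exact/ltW/rincr.
    by rewrite (_ : j = ord_left k)//; exact: val_inj.
  rewrite lt_eqF//; apply: (lt_le_trans xk).
  move: kj; rewrite leq_eqVlt => /orP[/eqP jk|jk]; last exact/ltW/rincr.
  by rewrite (_ : j = ord_right k)//; exact: val_inj.
have Hd := is_derive_powprod m xr.
split=> [H0|H0]; last by rewrite -[0](mulr0 (powprod m r x)) -H0.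
have : powprod m r x * (\sum_(j < N) m j / (x - r j)) = 0.
  by rewrite -(@derive_val _ _ _ _ _ _ _ Hd) (@derive_val _ _ _ _ _ _ _ H0).
move=> /eqP; rewrite mulf_eq0 => /orP[|/eqP//].
rewrite gt_eqF// prodr_gt0// => j _.
by rewrite powR_gt0// normr_gt0 subr_eq0.
Qed.

(* Main.v *)
From mathcomp Require Import mpoly.
Require Import Defs.
From mathcomp Require Import all_boot all_order all_algebra.
From mathcomp Require Import reals ring zify.

(** The ratios are unchanged when all nodes [r_j] are moved by an affine map, so
    the two lowest nodes may be taken to be 0 and 1. With N = n + 2 there remain
    n free nodes, the parameters t_1, .., t_n, while there are n + 1 ratios. Each
    ratio is algebraic over the parameters: substituting
    x_k = r_k + sigma_k (r_(k+1) - r_k) in the equation sum_j m_j / (x_k - r_j) = 0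
    and clearing denominators gives a polynomial equation [ratio_eqn] for sigma_k
    whose coefficients are polynomials in t. Its coefficient of degree n + 1 is
    (sum_j m_j) (r_(k+1) - r_k)^(n+1), which never vanishes because the m_j are
    positive. As n + 1 quantities algebraic over n parameters are algebraically
    dependent, a relation Q exists.

    To get one Q for all values of the parameters at once, the dependence
    ([algebraic_dependence]) is proved by counting. Let L be the product of the
    leading coefficients of the equations. For exponents a_k <= D, the
    product of L^D with the monomial of exponents a_k in the ratios is, modulo the
    equations, a combination of the boundedly many monomials with exponents
    at most n, with coefficients polynomials in t of degree O(D)
    ([pseudo_remainder_bound]). These live in a space of dimension O(D^n),
    whereas there are (D + 1)^(n+1) monomials: for large D some nontrivial
    combination Q of the monomials satisfies L^D Q = 0 at every ratio vector, and
    L does not vanish there. *)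

Set Implicit Arguments.
Unset Strict Implicit.
Unset Printing Implicit Defensive.
Import Order.TTheory GRing.Theory Num.Theory.
Local Open Scope ring_scope.

(** * Algebraic dependence by counting monomials *)

Lemma nontrivial_left_kernel (K : fieldType) (I J : finType) (A : I -> J -> K) :
  (#|J| < #|I|)%N ->
  exists2 v : I -> K, exists i, v i != 0 & forall j, \sum_i v i * A i j = 0.
Proof.
move=> JI; pose M := \matrix_(i < #|I|, j < #|J|) A (enum_val i) (enum_val j).
have : kermx M != 0.
  rewrite kermx_eq0 /row_free; apply: contraTneq JI => rM.
  by rewrite -leqNgt -rM rank_leq_col.
case/rowV0Pn => u /sub_kermxP uM /rV0Pn[i0 ui0].
exists (fun i => u 0 (enum_rank i)).
  by exists (enum_val i0); rewrite enum_valK.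
move=> j; have := congr1 (fun B : 'rV_ _ => B 0 (enum_rank j)) uM.
rewrite !mxE => uMj; rewrite -[RHS]uMj [RHS](reindex (@enum_rank I)) /=; last first.
  by exists enum_val => i _; rewrite ?enum_valK ?enum_rankK.
by apply: eq_bigr => i _; rewrite mxE !enum_rankK.
Qed.

Lemma msizeM_bound (K : idomainType) n d e (p q : {mpoly K[n]}) :
  (msize p <= d.+1)%N -> (msize q <= e.+1)%N -> (msize (p * q) <= (d + e).+1)%N.
Proof.
move=> pd qe; have [->|p0] := eqVneq p 0; first by rewrite mul0r msize0.
have [->|q0] := eqVneq q 0; first by rewrite mulr0 msize0.
rewrite msizeM//; move: (msize p) (msize q) pd qe => a b; lia.
Qed.

Lemma msizeX_bound (K : idomainType) n d (p : {mpoly K[n]}) a :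
  (msize p <= d.+1)%N -> (msize (p ^+ a) <= (d * a).+1)%N.
Proof.
move=> pd; elim: a => [|a IH]; first by rewrite expr0 msize1.
by rewrite exprS mulnS msizeM_bound.
Qed.

Lemma msizeB_bound (K : nzRingType) n d (p q : {mpoly K[n]}) :
  (msize p <= d)%N -> (msize q <= d)%N -> (msize (p - q) <= d)%N.
Proof.
move=> pd qd; apply: leq_trans (msizeD_le _ _) _.
by rewrite msizeN geq_max pd.
Qed.

Lemma msize_prod_bound (K : idomainType) n d (I : finType)
    (p : I -> {mpoly K[n]}) :
  (forall i, msize (p i) <= d.+1)%N -> (msize (\prod_i p i) <= (d * #|I|).+1)%N.
Proof.
move=> pd; rewrite cardE /index_enum -enumT; elim: (enum I) => [|i s IH].
  by rewrite big_nil msize1.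
by rewrite big_cons /= mulnS msizeM_bound.
Qed.

(** Repeated replacement of the top coefficient of [rem * 'X] by means of [F]
    multiplies by one leading coefficient per step, so each step raises the
    degree in the parameters by at most [d]: growth is linear in [a], which is
    what the counting argument needs. *)
Lemma pseudo_remainder_bound (K : idomainType) n (F : {poly {mpoly K[n]}}) e d a :
  (size F <= e.+2)%N -> (forall b, msize F`_b <= d.+1)%N ->
  exists rem quo : {poly {mpoly K[n]}},
    [/\ (F`_e.+1 ^+ a)%:P * 'X^a = rem + quo * F, (size rem <= e.+1)%N
      & forall b, (msize rem`_b <= (d * a).+1)%N].
Proof.
move=> sF dF; elim: a => [|a [rem [quo [E sr dr]]]].
  exists 1, 0; rewrite !expr0 mul0r addr0 mul1r size_poly1; split=> // b.
  by rewrite coef1; case: eqP => _; rewrite ?msize1 ?msize0.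
pose l := F`_e.+1; pose c := rem`_e.
pose rem' := l%:P * (rem * 'X) - c%:P * F.
have rem'b b : rem'`_b = l * (if b is b'.+1 then rem`_b' else 0) - c * F`_b.
  by rewrite coefB !coefCM coefMX; case: b.
exists rem', (l%:P * 'X * quo + c%:P); split.
- rewrite /rem' !exprS -/l polyCM.
  rewrite (_ : _ * _ = l%:P * 'X * ((l ^+ a)%:P * 'X^a)); last by ring.
  by rewrite E; ring.
- apply/leq_sizeP => -[//|b]; rewrite rem'b ltnS leq_eqVlt => /predU1P[<-|eb].
    by rewrite mulrC subrr.
  by rewrite (nth_default _ (leq_trans sr eb)) (nth_default _ (leq_trans sF _))
    ?mulr0 ?subr0.
- move=> b; rewrite rem'b mulnS; apply: msizeB_bound.
    apply: msizeM_bound (dF _) _; by case: b => [|b]; rewrite ?msize0 ?dr.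
  rewrite [(d + _)%N]addnC; exact: msizeM_bound (dr _) (dF _).
Qed.

(** The inequality that makes the linear system for the coefficients of Q
    underdetermined: powers of D count, and [g], [f] are constants. *)
Lemma monomial_count (n f g D : nat) : (f * g.+1 ^ n <= D)%N ->
  (f * (g * D).+1 ^ n < D.+1 ^ n.+1)%N.
Proof.
move=> fgD; have: (f * (g.+1 * D.+1) ^ n < D.+1 ^ n.+1)%N.
  by rewrite expnMn mulnA expnS ltn_pmul2r ?expn_gt0.
apply: leq_ltn_trans; rewrite leq_mul2l; apply/orP; right.
have [->//|n0] := posnP n; rewrite leq_exp2r//; nia.
Qed.

(** Exponents range over a box rather than over the simplex of multidegrees below
    [B] because the size of a box is a plain power, which is what
    [monomial_count] compares. *)
Lemma mpoly_eq0_box (K : nzRingType) (n B : nat) (p : {mpoly K[n]}) :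
  (msize p <= B)%N ->
  (forall h : {ffun 'I_n -> 'I_B}, p@_[multinom (h i : nat) | i < n] = 0) ->
  p = 0.
Proof.
move=> pB p0; apply/mpolyP => m; rewrite mcoeff0.
have [mB|Bm] := ltnP (mdeg m) B; last first.
  by apply/memN_msupp_eq0/msize_mdeg_ge/(leq_trans pB).
have miB i : (m i < B)%N.
  by apply: leq_ltn_trans mB; rewrite mdegE (bigD1 i) //= leq_addr.
have := p0 [ffun i => Ordinal (miB i)]; congr (_@_ _ = _).
by apply/mnmP => i; rewrite mnmE ffunE.
Qed.

(** [n.+1] elements algebraic over [n] parameters satisfy a relation that is
    uniform in the specialization [t] of the parameters, as long as the leading
    coefficients survive it. Reducing the powers of each [u k] modulo its equation
    turns the monomials in [u] into vectors of a space that is too small for them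
    to be independent. *)
Theorem algebraic_dependence (K : fieldType) (n e : nat)
    (F : 'I_n.+1 -> {poly {mpoly K[n]}}) :
  (forall k, size (F k) <= e.+2)%N ->
  exists2 Q : {mpoly K[n.+1]}, Q != 0 &
    forall (t : 'I_n -> K) (u : 'I_n.+1 -> K),
      (forall k, (map_poly (meval t) (F k)).[u k] = 0) ->
      (forall k, meval t (F k)`_e.+1 != 0) -> meval u Q = 0.
Proof.
move=> sF.
pose d := (\max_k \max_(b < e.+2) msize (F k)`_b)%N.
have dF k b : (msize (F k)`_b <= d.+1)%N.
  have [be|eb] := ltnP b e.+2; last first.
    by rewrite nth_default ?msize0// (leq_trans (sF k)).
  apply: leqW; apply: leq_trans (leq_bigmax k).
  exact: (leq_bigmax (F := fun b : 'I__ => msize (F k)`_b) (Ordinal be)).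
pose g := (d * n.+1)%N.
have [D fgD] : exists D, (e.+1 ^ n.+1 * g.+1 ^ n <= D)%N by eexists.
pose l k := (F k)`_e.+1.
(* The factor l ^ (D - a) gives all the powers of u k the same denominator. *)
have red k (a : 'I_D.+1) : exists rem : {poly {mpoly K[n]}},
   [/\ (size rem <= e.+1)%N, (forall b, (msize rem`_b <= (d * D).+1)%N) &
    exists quo, (l k ^+ D)%:P * 'X^a = rem + quo * F k].
  have [rem [quo [E sr dr]]] := pseudo_remainder_bound a (sF k) (dF k).
  have aD : (a <= D)%N by rewrite -ltnS.
  exists ((l k ^+ (D - a))%:P * rem); split.
  - by rewrite mul_polyC (leq_trans (size_scale_leq _ _)).
  - move=> b; rewrite coefCM -[(d * D)%N](congr1 (muln d) (subnK aD)) mulnDr.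
    exact: msizeM_bound (msizeX_bound _ (dF k e.+1)) (dr b).
  - exists ((l k ^+ (D - a))%:P * quo).
    rewrite -[l k ^+ D](congr1 (GRing.exp (l k)) (subnK aD)) exprD polyCM.
    by rewrite -mulrA E; ring.
have /fin_all_exists[rem remP] (i : 'I_n.+1 * 'I_D.+1) := red i.1 i.2.
(* [G a f] is the coefficient, polynomial in the parameters, of the monomial with
   exponents [f] in the reduction of the monomial with exponents [a]. *)
pose G (a : {ffun 'I_n.+1 -> 'I_D.+1}) (f : {ffun 'I_n.+1 -> 'I_e.+1}) :=
  \prod_k (rem (k, a k))`_(f k).
pose B := (g * D).+1.
have GB a f : (msize (G a f) <= B)%N.
  rewrite /B /g -mulnA [(n.+1 * D)%N]mulnC mulnA -[n.+1 in leqRHS]card_ord.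
  by apply: msize_prod_bound => k; case: (remP (k, a k)).
pose A a (j : {ffun 'I_n.+1 -> 'I_e.+1} * {ffun 'I_n -> 'I_B}) :=
  (G a j.1)@_[multinom (j.2 i : nat) | i < n].
have [|v [a0 va0] vA] := nontrivial_left_kernel A.
  by rewrite card_prod !card_ffun !card_ord monomial_count.
have vG f : \sum_a v a *: G a f = 0.
  apply: (mpoly_eq0_box (B := B)).
    apply: leq_trans (msize_sum _ _ _) _; apply/bigmax_leqP => a _.
    exact: leq_trans (msizeZ_le _ _) (GB a f).
  move=> h; rewrite -[RHS](vA (f, h)) raddf_sum; apply: eq_bigr => a _ /=.
  by rewrite mcoeffZ.
pose mon (a : {ffun 'I_n.+1 -> 'I_D.+1}) := [multinom (a i : nat) | i < n.+1].
have mon_inj : injective mon.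
  move=> a b /mnmP ab; apply/ffunP => i; apply: val_inj.
  by have := ab i; rewrite !mnmE.
exists (\sum_a v a *: 'X_[mon a]).
  apply: contraNneq va0 => /(congr1 (mcoeff (mon a0))).
  rewrite mcoeff0 raddf_sum (bigD1 a0) //= big1 => [|a aa0].
    by rewrite mcoeffZ mcoeffX eqxx mulr1 addr0 => ->.
  by rewrite mcoeffZ mcoeffX (inj_eq mon_inj) (negPf aa0) mulr0.
move=> t u Fu lt.
have lu k (a : 'I_D.+1) : meval t (l k) ^+ D * u k ^+ a =
    \sum_(b < e.+1) meval t (rem (k, a))`_b * u k ^+ b.
  have [sr _ [quo E]] := remP (k, a).
  have := congr1 (fun p => (map_poly (meval t) p).[u k]) E.
  rewrite /= !rmorphM rmorphD rmorphM /= hornerD !hornerM Fu mulr0 addr0.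
  rewrite map_polyC map_polyXn hornerC hornerXn /= rmorphXn /= => ->.
  rewrite (horner_coef_wide (n := e.+1)).
    by apply: eq_bigr => b _; rewrite coef_map.
  exact: leq_trans (size_poly _ _) sr.
(* Multiplying Q by the nonzero common denominator reduces each monomial, and the
   coefficients of the reductions cancel by the choice of [v]. *)
have L0 : \prod_k meval t (l k) ^+ D != 0.
  by apply/prodf_neq0 => k _; exact: expf_neq0 (lt k).
apply: (mulfI L0); rewrite mulr0 raddf_sum /= mulr_sumr.
transitivity (\sum_(f : {ffun 'I_n.+1 -> 'I_e.+1})
    (\prod_k u k ^+ f k) * meval t (\sum_a v a *: G a f));
  last by rewrite big1 // => f _; rewrite vG meval0 mulr0.
under [RHS]eq_bigr do rewrite raddf_sum mulr_sumr.
rewrite exchange_big; apply: eq_bigr => a _ /=.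
rewrite mevalZ mevalX mulrCA -big_split /=.
under eq_bigr => k _ do rewrite mnmE lu.
rewrite bigA_distr_bigA mulr_sumr; apply: eq_bigr => f _ /=.
by rewrite mevalZ mulrCA rmorph_prod -big_split; congr (_ * _);
  apply: eq_bigr => k _; rewrite mulrC.
Qed.

(** * The equations of the ratios *)

Lemma prod_linear_size_lead (A : comNzRingType) n (a : A) (b : 'I_n -> A) :
  let p := \prod_(i < n) (a%:P * 'X + (b i)%:P) in
  (size p <= n.+1)%N /\ p`_n = a ^+ n.
Proof.
elim: n b => [|n IH] b /=.
  by rewrite big_ord0 size_poly1 coef1.
rewrite big_ord_recl /=; have [] := IH (fun i => b (lift ord0 i)).
move: (\prod_(i < n) _) => p sp lp; have pn : p`_n.+1 = 0 by rewrite nth_default.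
rewrite mulrDl -mulrA coefD !coefCM coefXM /= pn mulr0 addr0 lp exprS; split=> //.
apply/leq_sizeP => -[//|i] ni; have pi := leq_trans sp ni.
by rewrite coefD !coefCM coefXM /= !nth_default ?mulr0 ?addr0// leqW.
Qed.

(** The node [r j] after the affine change of variable that sends the two lowest
    nodes to 0 and 1, the other nodes being indeterminates. *)
Definition normal_node (K : nzRingType) n (j : 'I_n.+2) : {mpoly K[n]} :=
  if unlift ord0 j is Some j' then
    if unlift ord0 j' is Some i then 'X_i else 1
  else 0.

Lemma meval_normal_node (K : fieldType) n (r : 'I_n.+2 -> K) :
  let r0 := r ord0 in let r1 := r (lift ord0 ord0) in r0 != r1 ->
  exists t, forall j, meval t (normal_node K j) = (r j - r0) / (r1 - r0).
Proof.
move=> r0 r1 r01.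
exists (fun i => (r (lift ord0 (lift ord0 i)) - r0) / (r1 - r0)) => j.
rewrite /normal_node; case: unliftP => [j' ->|->]; last first.
  by rewrite meval0 subrr mul0r.
case: unliftP => [i ->|->]; first by rewrite mevalXU.
by rewrite meval1 divff// subr_eq0 eq_sym.
Qed.

(** With the unknown 'X standing for the [k]-th ratio, each linear factor is
    [x_k - rho (lift j i)] for the [k]-th critical point [x_k]: this is the
    numerator of the logarithmic derivative p'/p, evaluated at [x_k]. *)
Definition ratio_eqn (K : nzRingType) n (m : 'I_n.+2 -> K) (k : 'I_n.+2.-1) :
    {poly {mpoly K[n]}} :=
  let rho := @normal_node K n in let l := ord_left k in
  \sum_j (m j)%:MP *: \prod_(i < n.+1)
    ((rho (ord_right k) - rho l)%:P * 'X + (rho l - rho (lift j i))%:P).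

Lemma ratio_eqn_size_lead (K : comNzRingType) n (m : 'I_n.+2 -> K) k :
  (size (ratio_eqn m k) <= n.+2)%N /\
  (ratio_eqn m k)`_n.+1 =
    (\sum_j m j)%:MP *
    (normal_node K (ord_right k) - normal_node K (ord_left k)) ^+ n.+1.
Proof.
pose a := normal_node K (ord_right k) - normal_node K (ord_left k).
pose p (j : 'I_n.+2) := prod_linear_size_lead a
  (fun i : 'I_n.+1 => normal_node K (ord_left k) - normal_node K (lift j i)).
split.
  apply: leq_trans (size_sum _ _ _) _; apply/bigmax_leqP => j _.
  by apply: leq_trans (size_scale_leq _ _) _; case: (p j).
rewrite coef_sum raddf_sum mulr_suml; apply: eq_bigr => j _ /=.
by rewrite coefZ; congr (_ * _); case: (p j).
Qed.

Lemma sum_prod_lift0 (K : fieldType) n (m y : 'I_n.+1 -> K) :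
  (forall j, y j != 0) -> \sum_j m j / y j = 0 ->
  \sum_j m j * \prod_i y (lift j i) = 0.
Proof.
move=> y0 my.
suff -> : \sum_j m j * \prod_i y (lift j i) =
    (\prod_j y j) * \sum_j m j / y j by rewrite my mulr0.
rewrite mulr_sumr; apply: eq_bigr => j _; rewrite [\prod_j y j](bigD1_ord j) //=.
by field.
Qed.

(** The scale [c] is the distance between the two lowest nodes: each factor
    evaluates to [(x - r i) / c], and a rescaling of all the factors preserves the
    critical equation. *)
Lemma ratio_eqn_root (K : fieldType) n (m r : 'I_n.+2 -> K) t c k x :
  c != 0 ->
  (forall j, meval t (normal_node K j) = (r j - r ord0) / c) ->
  r (ord_left k) != r (ord_right k) ->
  (forall j, x != r j) -> \sum_j m j / (x - r j) = 0 ->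
  (map_poly (meval t) (ratio_eqn m k)).[
     (x - r (ord_left k)) / (r (ord_right k) - r (ord_left k))] = 0.
Proof.
move=> c0 tr lr xr mx; rewrite /ratio_eqn raddf_sum horner_sum.
rewrite -[RHS](@sum_prod_lift0 _ _ m (fun j => (x - r j) / c)).
- apply: eq_bigr => j _ /=.
  rewrite map_polyZ hornerZ /= mevalC rmorph_prod horner_prod; congr (_ * _).
  apply: eq_bigr => i _ /=.
  rewrite rmorphD rmorphM /= map_polyX !map_polyC !hornerE /= !mevalB !tr.
  by field; rewrite c0 subr_eq0 eq_sym lr.
- by move=> j; rewrite mulf_neq0 ?invr_eq0 ?subr_eq0.
- under eq_bigr do rewrite invf_div mulrCA.
  by rewrite -mulr_sumr mx mulr0.
Qed.

Lemma between_neq (R : numDomainType) N (r : 'I_N -> R) (k : 'I_N.-1) x :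
  (forall i j : 'I_N, (i < j)%N -> r i < r j) ->
  r (ord_left k) < x < r (ord_right k) -> forall j, x != r j.
Proof.
move=> incr /andP[kx xk] j; have le_r (i i' : 'I_N) : (i <= i')%N -> r i <= r i'.
  by rewrite leq_eqVlt => /predU1P[/val_inj->//|/incr/ltW].
have [jk|kj] := leqP j k.
  by rewrite gt_eqF// (le_lt_trans _ kx)// le_r.
by rewrite lt_eqF// (lt_le_trans xk)// le_r.
Qed.

Theorem corollary13 (R : realType) (N : nat) (hN : (2 <= N)%N)
    (m : 'I_N -> R) (hm : forall j : 'I_N, 0 < m j) :
  exists Q : mpoly N.-1 R, Q != 0 /\
    forall (r : 'I_N -> R) (sigma : 'I_N.-1 -> R),
      (forall i j : 'I_N, (i < j)%N -> r i < r j) ->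
      ratio_vector m r sigma ->
      meval sigma Q = 0.
Proof.
case: N hN m hm => [//|[//|n]] _ m hm.
have [|Q Q0 Qvan] := @algebraic_dependence R n n (ratio_eqn m).
  by move=> k; case: (ratio_eqn_size_lead m k).
exists Q; split=> // r sigma incr [x xP].
have r01 : r ord0 != r (lift ord0 ord0) by rewrite lt_eqF// incr.
have [t tr] := meval_normal_node r01.
have c0 : r (lift ord0 ord0) - r ord0 != 0 by rewrite subr_eq0 eq_sym.
have lr k : r (ord_left k) != r (ord_right k) by rewrite lt_eqF// incr.
apply: (Qvan t) => k.
  have [xk ->] := xP k; have [xlr mx] := (critical_pointP m k (x k) incr).1 xk.
  by apply: (ratio_eqn_root c0) => //; apply: between_neq xlr.
have [_ ->] := ratio_eqn_size_lead m k.
rewrite mevalM mevalC rmorphXn /= mulf_neq0//.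
  by rewrite gt_eqF// (bigD1 ord0) //= ltr_pwDl ?sumr_ge0// => j _; apply: ltW.
rewrite expf_neq0// mevalB !tr -mulrBl mulf_neq0 ?invr_eq0//.
by rewrite opprB addrA subrK subr_eq0 eq_sym.
Qed.
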